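(* Let $n \ge 1$ and let $\mathcal{F}, \mathcal{G} \subseteq 2^{[n]}$ be a pair of intersecting, cross-Sperner set systems. Then $$|\mathcal{F}| + |\mathcal{G}| \le 2^{n-1},$$ and this bound is best possible (there exist such pairs with $|\mathcal{F}|+|\mathcal{G}| = 2^{n-1}$).
   Context: A set system $\mathcal{H}$ is intersecting if $H_1 \cap H_2 \neq \emptyset$ for all $H_1, H_2 \in \mathcal{H}$. Two set systems $\mathcal{F}, \mathcal{G}$ are intersecting, cross-Sperner if both $\mathcal{F}$ and $\mathcal{G}$ are intersecting and there are no $F \in \mathcal{F}$, $G \in \mathcal{G}$ with $F \subseteq G$ or $G \subseteq F$. *)

(* Defs.v *)
From mathcomp Require Import all_boot.

Set Implicit Arguments.
Unset Strict Implicit.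
Unset Printing Implicit Defensive.

(* Taking A = B, an intersecting system cannot contain the empty set. *)
Definition intersecting (T : finType) (H : {set {set T}}) : Prop :=
  {in H &, forall A B : {set T}, A :&: B != set0}.

Definition cross_Sperner (T : finType) (F G : {set {set T}}) : Prop :=
  {in F & G, forall A B : {set T}, ~~ (A \subset B) /\ ~~ (B \subset A)}.

Definition intersecting_cross_Sperner (T : finType) (F G : {set {set T}}) :
  Prop := [/\ intersecting F, intersecting G & cross_Sperner F G].

(* Main.v *)
Require Import Defs.
From mathcomp Require Import all_boot.
From mathcomp Require Import zify.

Set Implicit Arguments.
Unset Strict Implicit.
Unset Printing Implicit Defensive.

(* Say that a complementary pair [{A, ~: A}] is doubly used when [A \in F] and
   [~: A \in G], and let [K] be the family of such [A].  For [A, B \in K] the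
   difference [A :\: B] lies below [A \in F] and below [~: B \in G], while its
   complement lies above [~: A \in G] and above [B \in F]; by the cross-Sperner
   property neither of them is in [F] or [G].  By the Marica-Schonheim theorem
   there are at least [#|K|] such differences, and no two are complementary,
   so the unused pairs make up for the doubly used ones. *)

Section Differences.
Variable T : finType.
Implicit Types (x : T) (S X Y : {set T}) (A B F : {set {set T}}).

Definition setdiffs A B : {set {set T}} := [set X :\: Y | X in A, Y in B].

Lemma setdiffs_f A B X Y : X \in A -> Y \in B -> X :\: Y \in setdiffs A B.
Proof. by move=> XA YB; apply/imset2P; exists X Y. Qed.

(** Both families consist of sets avoiding [x], so splitting [F] into them shrinks the ground set
    for an induction. *)
Definition deletion x F : {set {set T}} := [set X in F | x \notin X].
Definition link x F : {set {set T}} :=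
  [set X : {set T} | (x \notin X) && (x |: X \in F)].

Lemma card_deletion_link x F : #|F| = #|deletion x F| + #|link x F|.
Proof.
have inj : {in link x F &, injective (fun X : {set T} => x |: X)}.
  move=> X Y; rewrite !inE => /andP[xX _] /andP[xY _] eXY.
  by rewrite -(setU1K xX) -(setU1K xY) eXY.
rewrite -(card_in_imset inj) -(cardsID [set X : {set T} | x \notin X] F).
congr (_ + _); apply: eq_card => X; first by rewrite !inE.
rewrite !inE negbK; apply/andP/imsetP => [[xX XF]|[Y]].
  by exists (X :\ x); rewrite ?setD1K // !inE eqxx /= setD1K.
by rewrite !inE => /andP[xY YF] ->; rewrite setU11.
Qed.

Lemma deletion_sub x S F : {in F, forall X, X \subset S} ->
  {in deletion x F, forall X, X \subset S :\ x}.
Proof. by move=> FS X; rewrite inE subsetD1 => /andP[/FS-> ->]. Qed.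

Lemma link_sub x S F : {in F, forall X, X \subset S} ->
  {in link x F, forall X, X \subset S :\ x}.
Proof.
move=> FS X; rewrite inE subsetD1 => /andP[-> /FS].
by rewrite subUset => /andP[_ ->].
Qed.

(** A difference [X :\: Y] contains [x] only if [x] lies in [X] and not in [Y]. So of the four
    combinations of deletion and link, only link minus deletion lands in the link. *)
Lemma setdiffs_deletion x A B :
  setdiffs (deletion x A) (deletion x B) \subset deletion x (setdiffs A B).
Proof.
apply/subsetP => _ /imset2P[X Y /[!inE] /andP[XA xX] /andP[YB xY] ->].
by rewrite setdiffs_f // !inE negb_and xX orbT.
Qed.

Lemma setdiffs_link x A B :
  setdiffs (link x A) (link x B) \subset deletion x (setdiffs A B).
Proof.
apply/subsetP => _ /imset2P[X Y /[!inE] /andP[xX XA] /andP[xY YB] ->].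
have -> : X :\: Y = (x |: X) :\: (x |: Y).
  by apply/setP=> z; rewrite !inE; case: eqP => [->|//]; rewrite (negPf xX) andbF.
by rewrite setdiffs_f // !inE eqxx.
Qed.

Lemma setdiffs_deletion_link x A B :
  setdiffs (deletion x A) (link x B) \subset deletion x (setdiffs A B).
Proof.
apply/subsetP => _ /imset2P[X Y /[!inE] /andP[XA xX] /andP[xY YB] ->].
have -> : X :\: Y = X :\: (x |: Y).
  by apply/setP=> z; rewrite !inE; case: eqP => [->|//]; rewrite (negPf xX) andbF.
by rewrite setdiffs_f // !inE eqxx.
Qed.

Lemma setdiffs_link_deletion x A B :
  setdiffs (link x A) (deletion x B) \subset link x (setdiffs A B).
Proof.
apply/subsetP => _ /imset2P[X Y /[!inE] /andP[xX XA] /andP[YB xY] ->].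
rewrite in_setD (negPf xX) andbF /=.
suff -> : x |: X :\: Y = (x |: X) :\: Y by rewrite setdiffs_f.
by apply/setP=> z; rewrite !inE; case: eqP => [->|//]; rewrite (negPf xY).
Qed.

(** The mixed products are bounded directly by the last two hypotheses. Multiplied together, these
    also bound the product of the two remaining terms by [(p * r) * (q * s)], and each of those
    terms is at most [p * r]. *)
Lemma leq_mul_sumD a0 a1 b0 b1 p q r s :
  a0 * b0 <= p * r -> a1 * b1 <= p * r -> a1 * b0 <= q * r ->
  a0 * b1 <= p * s -> (a0 + a1) * (b0 + b1) <= (p + q) * (r + s).
Proof.
move=> h00 h11 h10 h01.
suff: a0 * b0 + a1 * b1 <= p * r + q * s by lia.
have: (a0 * b0) * (a1 * b1) <= (p * r) * (q * s).
  by have := leq_mul h10 h01; lia.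
move: h00 h11; move: (a0 * b0) (a1 * b1) (p * r) (q * s) => u v y z uy vy uvyz.
(* [(y - u) * (y - v) >= 0] gives [y * (u + v) <= y * y + u * v <= y * (y + z)] *)
have [y0|y_gt0] := posnP y; first by lia.
by rewrite -(leq_pmul2l y_gt0); nia.
Qed.

(* The product form, for two families, is what survives the induction. *)
Lemma leq_card_mul_setdiffs A B :
  #|A| * #|B| <= #|setdiffs A B| * #|setdiffs B A|.
Proof.
(* The ground set becomes a variable subset [S], so that the induction can remove points without
   changing the type. *)
suff main m : forall S A B, #|S| = m -> {in A, forall X, X \subset S} ->
    {in B, forall X, X \subset S} ->
    #|A| * #|B| <= #|setdiffs A B| * #|setdiffs B A|.
  by apply: (main _ [set: T]) => // X _; apply: subsetT.
elim: m => [|m IHm] S {}A {}B cardS AS BS.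
  have S0 : S = set0 by apply/eqP; rewrite -cards_eq0 cardS.
  have small F : {in F, forall X, X \subset S} -> #|F| <= 1.
    move=> FS; rewrite -(cards1 (@set0 T)); apply/subset_leq_card/subsetP => X /FS.
    by rewrite S0 subset0 inE.
  have [->|[X XA]] := set_0Vmem A; first by rewrite cards0.
  have [->|[Y YB]] := set_0Vmem B; first by rewrite cards0 muln0.
  apply: (@leq_trans 1); first by rewrite (leq_mul (small _ AS) (small _ BS)).
  rewrite muln_gt0; apply/andP; split; apply/card_gt0P.
    by exists (X :\: Y); apply: setdiffs_f.
  by exists (Y :\: X); apply: setdiffs_f.
have [x xS] : exists x, x \in S by apply/card_gt0P; rewrite cardS.
have cardSx : #|S :\ x| = m by move: cardS; rewrite (cardsD1 x) xS => -[].
have [A0 A1] := (deletion_sub (x := x) AS, link_sub (x := x) AS).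
have [B0 B1] := (deletion_sub (x := x) BS, link_sub (x := x) BS).
rewrite (card_deletion_link x A) (card_deletion_link x B).
rewrite (card_deletion_link x (setdiffs A B)) (card_deletion_link x (setdiffs B A)).
(* Here [p], [q] count the deletion and link of [setdiffs A B], and [r], [s] those of
   [setdiffs B A]. *)
apply: leq_mul_sumD.
- apply: leq_trans (IHm _ _ _ cardSx A0 B0) _.
  by apply: leq_mul; apply: subset_leq_card; apply: setdiffs_deletion.
- apply: leq_trans (IHm _ _ _ cardSx A1 B1) _.
  by apply: leq_mul; apply: subset_leq_card; apply: setdiffs_link.
- apply: leq_trans (IHm _ _ _ cardSx A1 B0) _.
  apply: leq_mul; apply: subset_leq_card; first exact: setdiffs_link_deletion.
  exact: setdiffs_deletion_link.
- apply: leq_trans (IHm _ _ _ cardSx A0 B1) _.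
  apply: leq_mul; apply: subset_leq_card; first exact: setdiffs_deletion_link.
  exact: setdiffs_link_deletion.
Qed.

Theorem Marica_Schonheim A : #|A| <= #|setdiffs A A|.
Proof. by rewrite -leq_sqr; apply: leq_card_mul_setdiffs. Qed.

End Differences.

Section ComplementFree.
Variable T : finType.
Implicit Types (X Y : {set T}) (F G H : {set {set T}}).

Lemma card_set_type : #|{set T}| = 2 ^ #|T|.
Proof. by rewrite -[LHS]cardsT -powersetT card_powerset cardsT. Qed.

Lemma card_preim_setC H : #|@setC T @^-1: H| = #|H|.
Proof. by apply: on_card_preimset; exists (@setC T) => X _; rewrite setCK. Qed.

(** [H] and its image under complementation are disjoint and equinumerous. *)
Lemma leq_card_compl_free H :
  {in H, forall X, ~: X \notin H} -> #|H|.*2 <= 2 ^ #|T|.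
Proof.
move=> HC; have dis : [disjoint H & @setC T @^-1: H].
  by apply/pred0P => X /=; apply/andP => -[/HC/negPf XH]; rewrite inE XH.
rewrite -addnn -{2}card_preim_setC -cardsUI disjoint_setI0 // cards0 addn0.
by rewrite -card_set_type max_card.
Qed.

Lemma intersecting_compl F X : intersecting F -> X \in F -> ~: X \notin F.
Proof. by move=> iF XF; apply/negP => /(iF _ _ XF); rewrite setICr eqxx. Qed.

Lemma leq_card_intersecting_cross_Sperner F G :
  intersecting_cross_Sperner F G -> (#|F| + #|G|).*2 <= 2 ^ #|T|.
Proof.
case=> iF iG cs.
have FG X Y : X \in F -> Y \in G -> X \subset Y -> False.
  by move=> XF YG; case: (cs _ _ XF YG) => /negP.
have GF X Y : X \in F -> Y \in G -> Y \subset X -> False.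
  by move=> XF YG; case: (cs _ _ XF YG) => _ /negP.
(* [F :&: G'] is the family [K] of doubly used sets, and [D] its differences. *)
pose G' := @setC T @^-1: G; pose D := setdiffs (F :&: G') (F :&: G').
have dP Z : Z \in D -> exists X Y,
    [/\ X \in F, ~: X \in G, Y \in F, ~: Y \in G & Z = X :\: Y].
  case/imset2P => X Y /[!inE] /andP[XF XG] /andP[YF YG] ->.
  by exists X, Y.
have DF Z : Z \in D -> Z \notin F.
  case/dP => X [Y [XF XG YF YG ->]]; apply/negP => ZF.
  by apply: (FG _ _ ZF YG); rewrite setDE subsetIr.
have DG Z : Z \in D -> Z \notin G.
  case/dP => X [Y [XF XG YF YG ->]]; apply/negP => ZG.
  by apply: (GF _ _ XF ZG); rewrite subsetDl.
have DCF Z : Z \in D -> ~: Z \notin F.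
  case/dP => X [Y [XF XG YF YG ->]]; apply/negP => ZF.
  by apply: (GF _ _ ZF XG); rewrite setCS subsetDl.
have DCG Z : Z \in D -> ~: Z \notin G.
  case/dP => X [Y [XF XG YF YG ->]]; apply/negP => ZG.
  by apply: (FG _ _ YF ZG); rewrite setDE setCI setCK subsetUr.
(* If [~: (X :\: Y) = X' :\: Y'], then [~: X], in [G], would lie below [X'], in [F]. *)
have DCD Z : Z \in D -> ~: Z \notin D.
  case/dP => X [Y [XF XG YF YG ->]]; apply/negP.
  case/dP => X' [Y' [XF' _ _ _ e]]; apply: (GF _ _ XF' XG).
  by apply: subset_trans (subsetDl X' Y'); rewrite -e setCS subsetDl.
have FnG X : X \in F -> X \notin G by move=> XF; apply/negP => /(FG _ _ XF); apply.
(* The overlap [F :&: G'], lost on passing to the union, is regained from [D]. *)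
have le_card : #|F| + #|G| <= #|(F :|: G') :|: D|.
  have dis : [disjoint F :|: G' & D].
    apply/pred0P => Z /=; apply/andP => -[+ ZD].
    by rewrite !inE (negPf (DF _ ZD)) (negPf (DCG _ ZD)).
  have -> : #|F :|: G' :|: D| = #|F :|: G'| + #|D|.
    by rewrite -cardsUI disjoint_setI0 // cards0 addn0.
  rewrite -(card_preim_setC G) -(cardsUI F G') leq_add2l.
  exact: Marica_Schonheim.
rewrite -leq_double in le_card; apply: leq_trans le_card (leq_card_compl_free _).
(* It remains to see that no two members of [F :|: G' :|: D] are complementary. *)
move=> Z; rewrite !in_setU !negb_or => /orP[/orP[ZF|ZG']|ZD].
- rewrite intersecting_compl // inE setCK FnG //=.
  by apply/negP => /DCF; rewrite setCK ZF.
- have ZG : ~: Z \in G by rewrite inE in ZG'.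
  rewrite inE (intersecting_compl iG ZG) andbT; apply/andP; split.
    by apply: contraL ZG; apply: FnG.
  by apply: contraL ZG; apply: DG.
- by rewrite DCF // inE setCK DG // DCD.
Qed.

Lemma card_star (x : T) : #|[set X : {set T} | x \in X]|.*2 = 2 ^ #|T|.
Proof.
rewrite -card_set_type -(cardsC [set X : {set T} | x \in X]) -addnn; congr (_ + _).
have <- : @setC T @^-1: [set X : {set T} | x \in X] = ~: [set X : {set T} | x \in X].
  by apply/setP=> X; rewrite !inE.
by rewrite card_preim_setC.
Qed.

End ComplementFree.

Theorem theorem12 (n : nat) (hn : 1 <= n) :
  (forall F G : {set {set 'I_n}},
     intersecting_cross_Sperner F G -> #|F| + #|G| <= 2 ^ (n - 1)) /\
  (exists F G : {set {set 'I_n}},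
     intersecting_cross_Sperner F G /\ #|F| + #|G| = 2 ^ (n - 1)).
Proof.
have pow2 : 2 ^ n = (2 ^ (n - 1)).*2 by rewrite -mul2n -expnS subn1 prednK.
split=> [F G /leq_card_intersecting_cross_Sperner|].
  by rewrite card_ord pow2 leq_double.
pose x : 'I_n := Ordinal hn.
(* All sets through one point form half of the power set; with an empty second system the
   cross-Sperner condition is vacuous. *)
exists [set X : {set 'I_n} | x \in X], set0; split; last first.
  by rewrite cards0 addn0; apply: double_inj; rewrite card_star card_ord pow2.
split=> [X Y|X Y|X Y]; rewrite !inE // => xX xY.
by apply/set0Pn; exists x; rewrite inE xX.
Qed.
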